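(* For every $\epsilon>0$ there is an ergodic transverse $\mathbb{R}$-space $(X,\mu,Y)$ such that $$\iota_\mu(Y)<I_\mu(Y)<(1+\epsilon)\cdot\iota_\mu(Y).$$
   Context: Let $G=\mathbb{R}$ with Lebesgue measure $m_G$. A Borel $G$-space is a standard Borel space $X$ with a jointly Borel action $G\times X\to X$, $(g,x)\mapsto g.x$. For $Y\subseteq X$ and $x\in X$ put $Y_x=\{g\in G: g.x\in Y\}$. A subset of $G$ is locally finite if it meets every compact set in a finite set. A cross section of $X$ is a Borel set $Y\subseteq X$ with $Y_x$ nonempty and locally finite for every $x\in X$. A transverse $G$-space $(X,\mu,Y)$ consists of a Borel $G$-space $X$, a $G$-invariant Borel probability measure $\mu$ on $X$, and a Borel set $Y\subseteq X$ such that $G.Y$ (a Borel set) is $\mu$-conull, $Y_x$ is locally finite for all $x\in G.Y$, and $\int_X|Y_x\cap K|\,d\mu(x)<\infty$ for every compact $K\subset G$. It is ergodic if every $G$-invariant Borel subset of $X$ is $\mu$-null or $\mu$-conull. Transverse measure: for a $G$-invariant $\sigma$-finite measure $\mu$ on a Borel $G$-space $X$ for which $Y$ is a cross section (of $X$, or of a conull invariant Borel subset), $\mu_Y$ is the measure on $Y$ given by $\mu_Y(f)=\int_X\sum_{g\in Y_x}f(g.x)w(g)\,d\mu(x)$ for Borel $f:Y\to[0,+\infty]$, where $w:G\to[0,+\infty]$ is any Borel function with $\int_G w\,dm_G=1$; it is $\sigma$-finite and does not depend on $w$. The intensity is $\iota_\mu(Y)=\mu_Y(Y)$. Intersection covolume: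 let $Y^{[2]}=\{(g.y_1,g.y_2): g\in G,\ y_1,y_2\in Y\}\subseteq X\times X$, a Borel $G$-space under the diagonal action, having $Y\times Y$ as a cross section. There is exactly one $G$-invariant $\sigma$-finite Borel measure $\mu^{[2]}$ on $Y^{[2]}$ whose transverse measure on $Y\times Y$ is $\mu_Y\otimes\mu_Y$. Set $I_\mu(Y)=\mu^{[2]}(Y^{[2]})$. *)

(* Defs.v *)
From HB Require Import structures.
From mathcomp Require Import all_boot all_order all_algebra.
From mathcomp Require Import all_classical all_reals all_analysis.
From mathcomp Require Import measurable_realfun.

Set Implicit Arguments.
Unset Strict Implicit.
Unset Printing Implicit Defensive.

Import Order.TTheory GRing.Theory Num.Theory.
Import numFieldNormedType.Exports.

Local Open Scope classical_set_scope.
Local Open Scope ring_scope.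
Local Open Scope ereal_scope.

(* The acting group is the additive group of R. *)

(* Isomorphic to the Borel space of a separable complete metric space. A
   Hausdorff pseudo-metric space in the sense of pseudoMetricType is
   metrizable, its uniformity having a countable base. *)
Definition standard_borel (R : realType) d (X : measurableType d) : Prop :=
  exists (P : completePseudoMetricType R) (f : X -> P),
    [/\ hausdorff_space P,
        (exists2 D : set P, countable D & dense D),
        bijective f &
        forall A : set X, measurable A <-> <<s @open P >> (f @` A)].

Record borel_space (R : realType) d (X : measurableType d) (act : R -> X -> X)
    : Prop := {
  borel_space_standard : standard_borel R X ;
  borel_space_act0 : forall x, act 0%R x = x ;
  borel_space_actD : forall g h x, act (g + h)%R x = act g (act h x) ;
  borel_space_measurable :
    measurable_fun [set: R * X] (fun p => act p.1 p.2) }.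

Definition invariant_measure (R : realType) d (X : measurableType d)
    (act : R -> X -> X) (mu : {measure set X -> \bar R}) : Prop :=
  forall (g : R) (A : set X), measurable A -> mu (act g @^-1` A) = mu A.

(* Y_x *)
Definition hitting_set (R : realType) (X : Type) (act : R -> X -> X)
    (Y : set X) (x : X) : set R :=
  [set g | Y (act g x)].

(* G.Y *)
Definition saturation (R : realType) (X : Type) (act : R -> X -> X)
    (Y : set X) : set X :=
  [set x | exists g y, Y y /\ x = act g y].

Definition locally_finite (R : realType) (A : set R) : Prop :=
  forall K : set R, compact K -> finite_set (A `&` K).

Record transverse_space (R : realType) d (X : measurableType d)
    (act : R -> X -> X) (mu : probability X R) (Y : set X) : Prop := {
  transverse_space_borel : borel_space act ;
  transverse_space_invariant : invariant_measure act mu ;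
  transverse_space_measurable : measurable Y ;
  transverse_space_saturation : measurable (saturation act Y) ;
  transverse_space_conull : mu (~` saturation act Y) = 0 ;
  transverse_space_locally_finite :
    forall x, saturation act Y x -> locally_finite (hitting_set act Y x) ;
  transverse_space_integrable :
    forall K : set R, compact K ->
      \int[mu]_x counting (hitting_set act Y x `&` K) < +oo }.

Definition ergodic (R : realType) d (X : measurableType d)
    (act : R -> X -> X) (mu : probability X R) : Prop :=
  forall A : set X, measurable A -> (forall g, act g @^-1` A = A) ->
    mu A = 0 \/ mu (~` A) = 0.

(* Measures on a Borel subset of X are encoded as measures on X that vanish
   on its complement. The sum over Y_x is empty for x outside G.Y, so mu may
   live on a conull invariant set of which Y is a cross section. *)
Definition is_transverse_measure (R : realType) d (X : measurableType d)
    (act : R -> X -> X) (mu : {measure set X -> \bar R}) (Y : set X)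
    (nu : {measure set X -> \bar R}) : Prop :=
  nu (~` Y) = 0 /\
  forall w : R -> \bar R,
    measurable_fun [set: R] w ->
    (forall g, 0 <= w g) ->
    \int[lebesgue_measure]_g w g = 1 ->
  forall f : X -> \bar R,
    measurable_fun Y f ->
    (forall y, Y y -> 0 <= f y) ->
    \int[nu]_(y in Y) f y =
    \int[mu]_x \esum_(g in hitting_set act Y x) (f (act g x) * w g).

(* mu_Y: the properties in is_transverse_measure determine it on measurable
   sets (take f to be an indicator). The zero measure is only the default
   value of xget, taken when no such measure exists. *)
Definition transverse_measure (R : realType) d (X : measurableType d)
    (act : R -> X -> X) (mu : {measure set X -> \bar R}) (Y : set X)
    : {sigma_finite_measure set X -> \bar R} :=
  @xget {classic {sigma_finite_measure set X -> \bar R}} mzero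
    [set nu : {sigma_finite_measure set X -> \bar R} |
      is_transverse_measure act mu Y nu].

Definition intensity (R : realType) d (X : measurableType d)
    (act : R -> X -> X) (mu : {measure set X -> \bar R}) (Y : set X) : \bar R :=
  transverse_measure act mu Y Y.

Definition diagonal_action (R : realType) (X : Type) (act : R -> X -> X)
    (g : R) (z : X * X) : X * X :=
  (act g z.1, act g z.2).

(* Y^[2] is the saturation of Y x Y under the diagonal action. *)
Definition intersection_space (R : realType) (X : Type) (act : R -> X -> X)
    (Y : set X) : set (X * X) :=
  [set z | exists g y1 y2, [/\ Y y1, Y y2 & z = (act g y1, act g y2)]].

Definition is_intersection_measure (R : realType) d (X : measurableType d)
    (act : R -> X -> X) (mu : {measure set X -> \bar R}) (Y : set X)
    (mu2 : {measure set (X * X)%type -> \bar R}) : Prop :=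
  let muY := transverse_measure act mu Y in
  [/\ mu2 (~` intersection_space act Y) = 0,
      invariant_measure (diagonal_action act) mu2 &
      is_transverse_measure (diagonal_action act) mu2 (Y `*` Y) (muY \x muY)].

(* mu^[2]; as above, the zero measure is only a default value. *)
Definition intersection_measure (R : realType) d (X : measurableType d)
    (act : R -> X -> X) (mu : {measure set X -> \bar R}) (Y : set X)
    : {sigma_finite_measure set (X * X)%type -> \bar R} :=
  @xget {classic {sigma_finite_measure set (X * X)%type -> \bar R}} mzero
    [set mu2 : {sigma_finite_measure set (X * X)%type -> \bar R} |
      is_intersection_measure act mu Y mu2].

Definition intersection_covolume (R : realType) d (X : measurableType d)
    (act : R -> X -> X) (mu : {measure set X -> \bar R}) (Y : set X) : \bar R :=
  intersection_measure act mu Y (intersection_space act Y).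

(* Main.v *)
Require Import Defs.
From mathcomp Require Import all_boot all_order all_algebra.
From mathcomp Require Import all_classical all_reals all_analysis.
From mathcomp Require Import measurable_realfun.
From HB Require Import structures.
From mathcomp Require Import zify ring lra.

(** Let the real line act on a circle of length 1 carrying its Haar
    probability, and let Y be a finite subset. Each point of Y has transverse
    mass 1, so the intensity is the number of points of Y. The space Y^[2] is a
    union of closed orbits of length 1, one for each value of the difference
    y2 - y1 in the circle; on each of them the intersection measure is again
    the Haar probability, since the product of two unit masses is a unit mass.
    Hence the intersection covolume is the cardinality of the difference set
    Y - Y. For Y a finite subgroup the two numbers agree. Deleting one point
    from the subgroup of order m+1, with m > 1, leaves a set of m points
    whose difference set is still the whole subgroup, so that the intensity is
    m and the covolume is m+1. The ratio 1 + 1/m is smaller than 1 + eps as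
    soon as m is large.

    The circle is realized inside the standard Borel space R: the rotation flow
    moves every x within its unit interval [n, n+1), and the invariant
    probability is Lebesgue measure on [0, 1). The same description fits both
    the circle and Y^[2]: a finite family of orbits of period 1, parametrized by
    a measurable phase (orbit_family). For such a family, unfolding the
    integral over one period into an integral over the line shows that the
    transverse measure of the sum of the orbit probabilities is the counting
    measure on the finite cross section (lebesgue_unfolding,
    integral_transverse_sum, transverse_measure_orbits).

    The intensity and the covolume are defined through a choice among the
    measures with the required properties. The intensity follows because the
    transverse measure is determined on measurable sets
    (transverse_measure_unique). The covolume follows because the mass of the
    saturation can be read off from the transverse measure alone, by testing it
    against a set with one point on each orbit (saturation_mass). *)

Set Implicit Arguments.
Unset Strict Implicit.
Unset Printing Implicit Defensive.

Import Order.TTheory GRing.Theory Num.Theory.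
Import numFieldNormedType.Exports.

Local Open Scope classical_set_scope.
Local Open Scope ring_scope.
Local Open Scope ereal_scope.

Local Notation I01 := [set` `[0%R, 1%R[ ].

(** * Sums over the integers and fractional parts *)

Section esum_complements.
Context (R : realType).

Lemma esum_only (T : choiceType) (S : set T) (F : T -> \bar R) (x : T) :
  S x -> 0 <= F x -> (forall y, S y -> y <> x -> F y = 0) ->
  \esum_(y in S) F y = F x.
Proof.
move=> Sx Fx F0; rewrite -[RHS](@esum_set1 _ _ x F Fx).
rewrite esum_mkcond [RHS]esum_mkcond; apply: eq_esum => y _.
have [->|yx] := eqVneq y x; first by rewrite !mem_set.
rewrite [in RHS]memNset/=; last exact/eqP.
by case: ifPn => // /set_mem Sy; rewrite F0//; exact/eqP.
Qed.

(** Countable additivity of the integral is available for series indexed by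
    nat, whereas the translates of a period are indexed by the integers. *)
Lemma int_enumeration : exists2 e : nat -> int,
  injective e & forall n, exists k, e k = n.
Proof.
exists (fun k => if odd k then Negz k./2 else Posz k./2) => [i j|n].
  case: ifP => oi; case: ifP => oj // [ij];
    by rewrite -(odd_double_half i) -(odd_double_half j) oi oj ij.
case: n => n; first by exists n.*2; rewrite odd_double doubleK.
by exists n.*2.+1; rewrite /= odd_double /= uphalf_double.
Qed.

End esum_complements.

Section fractional_part.
Context (R : realType).
Implicit Types (x t : R) (n : int).

Definition fpart x : R := (x - (Num.floor x)%:~R)%R.

Lemma floorDint x n : Num.floor (x + n%:~R)%R = (Num.floor x + n)%R.
Proof. by rewrite floorDrz ?intr_int// intrKfloor. Qed.

Lemma fpart_ge0 x : (0 <= fpart x)%R.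
Proof. by rewrite subr_ge0; case/andP: (floor_itv x). Qed.

Lemma fpart_lt1 x : (fpart x < 1)%R.
Proof. by case/andP: (floor_itv x) => _; rewrite intrD1 /fpart; lra. Qed.

Lemma floor_fpart x : Num.floor (fpart x) = 0%R.
Proof. by apply: floor_def; rewrite fpart_ge0 add0r fpart_lt1. Qed.

Lemma fpartDint x n : fpart (x + n%:~R)%R = fpart x.
Proof. by rewrite /fpart floorDint intrD; ring. Qed.

Lemma fpart_floor x : x = (fpart x + (Num.floor x)%:~R)%R.
Proof. by rewrite /fpart subrK. Qed.

Lemma fpart_id x : (0 <= x < 1)%R -> fpart x = x.
Proof. by move=> x01; rewrite /fpart (@floor_def _ x 0%R) ?subr0. Qed.

Lemma fpartK x : fpart (fpart x) = fpart x.
Proof. by rewrite fpart_id// fpart_ge0 fpart_lt1. Qed.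

Lemma fpartDl x t : fpart (fpart x + t)%R = fpart (x + t)%R.
Proof.
rewrite -[in LHS](fpartDint _ (Num.floor x)); congr fpart.
by rewrite addrAC -fpart_floor.
Qed.

Lemma measurable_floor (D : set R) :
  measurable D -> measurable_fun D (fun x : R => (Num.floor x)%:~R : R).
Proof.
move=> mD; apply: nondecreasing_measurable => // x y xy.
by rewrite ler_int le_floor.
Qed.

Lemma measurable_fpart (D : set R) :
  measurable D -> measurable_fun D fpart.
Proof.
by move=> mD; apply: measurable_funB => //; exact: measurable_floor.
Qed.

(** Membership in [0, 1) becomes an equation, which is stable under the integer
    translations used for unfolding. *)
Lemma floor0E : [set` `[0%R, 1%R[ ] = [set x : R | Num.floor x = 0%R].
Proof.
apply/seteqP; split => x /=; rewrite in_itv/=.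
  by move=> x01; apply: floor_def; rewrite add0r.
by move=> x0; have := floor_itv x; rewrite x0 add0r.
Qed.

End fractional_part.

(** * Unfolding a period of the line *)

Section lebesgue_unfolding.
Context (R : realType).
Local Notation mu := (@lebesgue_measure R).

Lemma lebesgue_measure_reflect (c : R) (A : set R) : measurable A ->
  mu ((fun t : R => (c - t)%R) @^-1` A) = mu A.
Proof.
move=> mA; rewrite -[LHS]/(pushforward mu
  ((fun t => (c - t)%R) : _ -> measurableTypeR R) A).
apply/esym/lebesgue_measure_unique => //=.
  exact: measurable_funB.
move=> mf _ [[a b]] _ <-; rewrite /pushforward.
rewrite (_ : _ @^-1` _ = [set` `[c - b, c - a[%R])%R; last first.
  by apply/seteqP; split => x /=; rewrite !in_itv/=; lra.
rewrite !lebesgue_measure_itv/= !lte_fin.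
have -> : (c - b < c - a)%R = (a < b)%R by apply/idP/idP; lra.
by case: ifPn => // _; rewrite -!EFinB; congr _%:E; ring.
Qed.

Lemma lebesgue_measure_translate (c : R) (A : set R) : measurable A ->
  mu ((fun t : R => (c + t)%R) @^-1` A) = mu A.
Proof.
move=> mA; rewrite -(lebesgue_measure_reflect c mA).
rewrite -[RHS](lebesgue_measure_reflect 0).
  by congr (mu _); apply/seteqP; split => x /=; rewrite sub0r opprK.
by rewrite -[X in measurable X]setTI; apply: measurable_funB.
Qed.

Lemma ge0_integral_measure_preserving (phi : R -> R) (D : set R)
    (f : R -> \bar R) :
  measurable_fun [set: R] phi ->
  (forall A, measurable A -> mu (phi @^-1` A) = mu A) ->
  measurable D -> measurable_fun [set: R] f -> (forall x, 0 <= f x) ->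
  \int[mu]_(x in D) f x = \int[mu]_(t in phi @^-1` D) f (phi t).
Proof.
move=> mphi phimu mD mf f0.
transitivity (\int[pushforward mu
    (phi : measurableTypeR R -> measurableTypeR R)]_(x in D) f x).
  by apply: eq_measure_integral => //= A mA _; exact/esym/phimu.
rewrite ge0_integral_pushforward//.
exact: measurable_funS mf.
Qed.

(** The intervals h + n - [0, 1) tile the line as n runs over the integers, so
    summing w along a coset of the integers and then integrating over one period
    integrates w over the whole line. *)
Lemma lebesgue_unfolding (w : R -> \bar R) (h : R) :
  measurable_fun [set: R] w -> (forall t, 0 <= w t) ->
  measurable_fun [set: R] (fun t => \esum_(n in [set: int]) w (h + n%:~R - t)%R) /\
  \int[mu]_(t in I01) (\esum_(n in [set: int]) w (h + n%:~R - t)%R) =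
  \int[mu]_t w t.
Proof.
move=> mw w0; have [e einj esurj] := int_enumeration.
have eE t : \esum_(n in [set: int]) w (h + n%:~R - t)%R =
    \sum_(k <oo) w (h + (e k)%:~R - t)%R.
  rewrite nneseries_esumT//.
  by apply: reindex_esum; split => // [i j _ _ /einj//|n _]; have [k] := esurj n; exists k.
under eq_fun do rewrite eE.
have mwe k : measurable_fun [set: R] (fun t => w (h + (e k)%:~R - t)%R).
  by apply: (measurableT_comp mw); exact: measurable_funB.
split; first by apply: ge0_emeasurable_sum => // k t _ _; exact: w0.
rewrite integral_nneseries//; last by move=> k; exact: measurable_funS (mwe k).
(* After the reflection t |-> h - t, the k-th summand lives on the tile F k. *)
pose F k : set R := [set t | Num.floor t = - e k]%R.
have mF k : measurable (F k).
  rewrite (_ : F k = [set` `[ (- e k)%:~R, (- e k + 1)%:~R[ ]); first exact: measurable_itv.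
  apply/seteqP; split => x; rewrite /F /= in_itv/=.
    by move=> <-; exact: floor_itv.
  exact: floor_def.
rewrite [RHS](ge0_integral_measure_preserving (phi := fun t => (h - t)%R))//; last 2 first.
- by apply: measurable_funB.
- exact: lebesgue_measure_reflect.
rewrite preimage_setT (_ : [set: R] = \bigcup_k F k); last first.
  apply/esym; rewrite -subTset => t _; have [k ek] := esurj (- Num.floor t)%R.
  by exists k => //; rewrite /F /= ek opprK.
have mwh : measurable_fun [set: R] (fun t => w (h - t)%R).
  by apply: (measurableT_comp mw); exact: measurable_funB.
rewrite ge0_integral_bigcup//; last 2 first.
- by apply: measurable_funS mwh => //; exact: bigcupT_measurable.
- apply/trivIsetP => i j _ _ ij; rewrite -subset0 => t [/= ti tj].
  by move/eqP: ij; apply; apply: einj; apply: oppr_inj; rewrite -ti -tj.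
apply: eq_eseriesr => k _.
rewrite [RHS](ge0_integral_measure_preserving
  (phi := fun t => ((- e k)%:~R + t)%R))//; last 2 first.
- by apply: measurable_funD.
- exact: lebesgue_measure_translate.
rewrite floor0E (_ : _ @^-1` F k = [set t | Num.floor t = 0]%R); last first.
  apply/seteqP; split => t; rewrite /F/= addrC floorDint.
    by move=> /(canRL (addrK _)); rewrite subrr.
  by move=> ->; rewrite add0r.
by apply: eq_integral => t _; congr w; rewrite intrN; ring.
Qed.

Lemma lebesgue_measure01 : mu I01 = 1.
Proof. by rewrite lebesgue_measure_itv/= lte_fin ltr01 oppr0 adde0. Qed.

(** A measurable set of period 1 has the same mass in every window of length 1:
    by unfolding, this mass is the integral over one period of the indicator
    of the reflected set, whatever the position of the window. *)
Lemma lebesgue_measure_periodic (B : set R) (g : R) : measurable B ->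
  (forall t (n : int), B (t + n%:~R)%R = B t) ->
  mu ((fun t => g + t)%R @^-1` B `&` I01) = mu (B `&` I01).
Proof.
move=> mB periodB.
suff H x : mu ((fun t => x + t)%R @^-1` B `&` I01) =
    \int[mu]_(t in I01) (\1_B (- t)%R)%:E.
  rewrite H -(H 0%R); congr (mu _).
  by apply/seteqP; split => t /=; rewrite add0r.
pose S := B `&` (fun t => - x + t)%R @^-1` I01.
have mS : measurable S.
  apply: measurableI => //; rewrite -[X in measurable X]setTI.
  by apply: measurable_funD => //; exact: measurable_itv.
have -> : (fun t => x + t)%R @^-1` B `&` I01 = (fun t => x + t)%R @^-1` S.
  by apply/seteqP; split => t; rewrite /S/= addKr.
rewrite lebesgue_measure_translate//.
transitivity (\int[mu]_t (\1_S t)%:E); first by rewrite integral_indic// setIT.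
have [||_ <-] := @lebesgue_unfolding (fun t => (\1_S t)%:E) 0.
- exact/measurable_EFinP.
- by move=> t; rewrite lee_fin.
apply: eq_integral => t _.
(* The only integer translate of - t lying in the window. *)
pose n0 := (- Num.floor (- x - t)%R)%R.
have n0E : (- x + (0 + n0%:~R - t) = fpart (- x - t))%R.
  by rewrite /n0 intrN /fpart; ring.
rewrite (@esum_only _ _ _ _ n0)//.
  rewrite !indicE; congr ((_ : bool)%:R)%:E; apply/idP/idP; rewrite !inE.
    by move=> []; rewrite add0r addrC periodB.
  move=> Bt; split; first by rewrite add0r addrC periodB.
  by rewrite /= n0E in_itv/= fpart_ge0 fpart_lt1.
move=> n _ nn0; rewrite indicE memNset// => -[_].
rewrite /= in_itv/= => n01; apply: nn0; rewrite /n0.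
rewrite (@floor_def _ (- x - t)%R (- n)%R) ?opprK//.
by move: n01; rewrite intrD intrN; lra.
Qed.

End lebesgue_unfolding.
Lemma ge0_integral_mrestr d (T : measurableType d) (R : realType)
    (m : {measure set T -> \bar R}) (D : set T) (mD : measurable D)
    (f : T -> \bar R) :
  measurable_fun [set: T] f -> (forall x, 0 <= f x) ->
  \int[mrestr m mD]_x f x = \int[m]_(x in D) f x.
Proof.
move=> mf f0; have mDC : measurable (~` D) by exact: measurableC.
rewrite -(setUv D) ge0_integral_setU//; last 2 first.
- by rewrite setUv.
- by apply/disj_setPCl.
rewrite (eq_measure_integral m); last first.
  by move=> A mA AD; rewrite /= /mrestr setIidl.
rewrite [X in _ + X](eq_measure_integral mzero); last first.
  move=> A mA AD; rewrite /= /mrestr /mzero (_ : A `&` D = set0) ?measure0//.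
  by rewrite -subset0 => x [/AD].
by rewrite integral_measure_zero adde0.
Qed.

(** * The probability carried by one period of a curve *)

Section curve_measure.
Context (R : realType) d (Z : measurableType d).

Definition curve_measure (c : R -> Z)
    of measurable_fun [set: R] c : set Z -> \bar R :=
  pushforward (mrestr (@lebesgue_measure R) (measurable_itv `[0%R, 1%R[ )) c.

Section instances.
Variables (c : R -> Z) (mc : measurable_fun [set: R] c).

Let curve0 : curve_measure mc set0 = 0.
Proof. exact: measure0. Qed.

Let curve_ge0 A : 0 <= curve_measure mc A.
Proof. exact: measure_ge0. Qed.

Let curve_sigma_additive : semi_sigma_additive (curve_measure mc).
Proof. exact: measure_semi_sigma_additive. Qed.

HB.instance Definition _ := isMeasure.Build _ _ _ (curve_measure mc)
  curve0 curve_ge0 curve_sigma_additive.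

Let curve_setT : curve_measure mc [set: Z] = 1.
Proof.
rewrite /curve_measure /pushforward preimage_setT /= /mrestr setTI.
by rewrite lebesgue_measure_itv/= lte_fin ltr01 oppr0 adde0.
Qed.

HB.instance Definition _ := Measure_isProbability.Build _ _ _
  (curve_measure mc) curve_setT.

Lemma curve_measureE A :
  curve_measure mc A = lebesgue_measure (c @^-1` A `&` I01).
Proof. by []. Qed.

Lemma ge0_integral_curve (f : Z -> \bar R) :
  measurable_fun [set: Z] f -> (forall z, 0 <= f z) ->
  \int[curve_measure mc]_z f z = \int[lebesgue_measure]_(t in I01) f (c t).
Proof.
move=> mf f0.
pose m : {measure set (measurableTypeR R) -> \bar R} :=
  mrestr (@lebesgue_measure R) (measurable_itv `[0%R, 1%R[ ).
have := @ge0_integral_pushforward _ _ (measurableTypeR R) _ R c mc m [set: Z]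
  f measurableT mf (fun z _ => f0 z).
rewrite preimage_setT ge0_integral_mrestr//; last 2 first.
- exact: (measurableT_comp mf mc).
- by move=> x; exact: f0.
Qed.

End instances.

End curve_measure.

(** * Finite sums of probabilities *)

Section sum_probability.
Context d (T : measurableType d) (R : realType).
Variables (P : nat -> probability T R) (M : nat).

(** A named copy of msum, which carries the structure of a finite, hence
    sigma-finite, measure. *)
Definition sum_probability : set T -> \bar R := msum P M.

HB.instance Definition _ := Measure.on sum_probability.

Let sum_probability_fin : fin_num_fun sum_probability.
Proof.
move=> A mA; rewrite /sum_probability /msum sum_fin_num; apply/allP => x.
by move=> /mapP[i _ ->]; exact: fin_num_measure.
Qed.

HB.instance Definition _ := Measure_isFinite.Build _ _ _
  sum_probability sum_probability_fin.

Lemma ge0_integral_sum_probability (f : T -> \bar R) :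
  measurable_fun [set: T] f -> (forall x, 0 <= f x) ->
  \int[sum_probability]_x f x = \sum_(i < M) \int[P i]_x f x.
Proof. by move=> mf f0; rewrite ge0_integral_measure_sum. Qed.

End sum_probability.

(** * Finite families of orbits of period 1 *)

(** A family of M closed orbits, through the points p i, of a flow of period 1.
    The phase tau recovers the time parameter modulo 1; in particular every
    orbit has least period 1. *)
Record orbit_family (R : realType) d (Z : measurableType d) (act : R -> Z -> Z)
    (M : nat) (p : nat -> Z) (tau : Z -> R) : Prop := {
  family_act0 : forall z, act 0%R z = z ;
  family_actD : forall g h z, act (g + h)%R z = act g (act h z) ;
  family_period : forall z, act 1%R z = z ;
  family_curve : forall i, measurable_fun [set: R] (act^~ (p i)) ;
  family_phase : measurable_fun [set: Z] tau ;
  family_phaseE : forall i t, tau (act t (p i)) = fpart t ;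
  family_orbit : forall i, measurable (range (act^~ (p i))) ;
  family_disjoint : forall i j s t, (i < M)%N -> (j < M)%N ->
    act s (p i) = act t (p j) -> i = j }.

Section orbit_family.
Context (R : realType) d (Z : measurableType d) (act : R -> Z -> Z).
Context (M : nat) (p : nat -> Z) (tau : Z -> R).
Hypothesis (fam : orbit_family act M p tau).

Lemma act_int (n : int) z : act n%:~R z = z.
Proof.
have actn k z' : act k%:R z' = z'.
  elim: k => [|k IH]; first by rewrite (family_act0 fam).
  by rewrite -natr1 addrC (family_actD fam) IH (family_period fam).
case: n => n; first exact: actn.
rewrite NegzE intrN -[in LHS](actn n.+1 z) -(family_actD fam) addNr.
by rewrite (family_act0 fam).
Qed.

Lemma act_fpart t z : act (fpart t) z = act t z.
Proof.
by rewrite [in RHS](fpart_floor t) (family_actD fam) act_int.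
Qed.

Lemma act_phase i t : act (tau (act t (p i))) (p i) = act t (p i).
Proof. by rewrite (family_phaseE fam) act_fpart. Qed.

Variable Y : set Z.

(** The times at which the orbit of q visits Y during one period. *)
Definition hits (q : Z) : set R := hitting_set act Y q `&` I01.

(** From act t q, the set Y is reached exactly at the times h + n - t, where h is
    a visit of q within one period and n is an integer. *)
Lemma esum_hitting_set (f : Z -> \bar R) (w : R -> \bar R) (q : Z) (t : R) :
  (forall y, Y y -> 0 <= f y) -> (forall g, 0 <= w g) ->
  \esum_(g in hitting_set act Y (act t q)) (f (act g (act t q)) * w g) =
  \esum_(h in hits q) \esum_(n in [set: int])
     (f (act h q) * w (h + n%:~R - t)%R).
Proof.
move=> f0 w0; rewrite esum_esum; last first.
  by move=> h n [Yh _] _; rewrite mule_ge0// f0.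
have actE (h : R) n : act (h + n%:~R - t)%R (act t q) = act h q.
  by rewrite -(family_actD fam) subrK (family_actD fam) act_int.
rewrite (@reindex_esum _ _ _ (hits q `*`` fun=> [set: int]) _
  (fun k => k.1 + k.2%:~R - t)%R).
  by apply: eq_esum => -[h n] _ /=; rewrite actE.
split.
- by move=> [h n] [[/= Yh _] _]; rewrite /hitting_set/= actE.
- move=> [h n] [h' n']; rewrite !inE => -[[/= _ h01] _] [[/= _ h01'] _] hn.
  move: h01 h01'; rewrite /= !in_itv/= => h01 h01'.
  have {}hn : (h + n%:~R = h' + n'%:~R)%R by move: hn; lra.
  have hh' : h = h'.
    by rewrite -(fpart_id h01) -(fpart_id h01') -(fpartDint h n) hn fpartDint.
  by move: hn; rewrite hh' => /addrI/intr_inj ->.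
- move=> g Yg; exists (fpart (g + t)%R, Num.floor (g + t)%R) => /=; last first.
    by rewrite -fpart_floor addrK.
  split => //; split; last by rewrite /= in_itv/= fpart_ge0 fpart_lt1.
  by rewrite /hitting_set/= act_fpart (family_actD fam).
Qed.

Hypothesis finY : finite_set Y.
Hypothesis subY : Y `<=` \bigcup_(i < M) range (act^~ (p i)).

Lemma finite_hits i : finite_set (hits (p i)).
Proof.
apply: (@sub_finite_set _ _ (tau @` Y)); last exact: finite_image.
move=> h [Yh]; rewrite /= in_itv/= => h01; exists (act h (p i)) => //.
by rewrite (family_phaseE fam) fpart_id.
Qed.

Lemma hitting_set_orbit z : hitting_set act Y z !=set0 ->
  exists2 i, (i < M)%N & range (act^~ (p i)) z.
Proof.
move=> [g Yg]; have [i /= iM [t _ tz]] := subY Yg; exists i => //.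
exists (t - g)%R => //.
by rewrite addrC (family_actD fam) tz -(family_actD fam) addNr (family_act0 fam).
Qed.

(** An orbit index and a visiting time are coordinates on Y. *)
Lemma esum_orbits (f : Z -> \bar R) : (forall y, Y y -> 0 <= f y) ->
  \sum_(i < M) \esum_(h in hits (p i)) f (act h (p i)) = \esum_(y in Y) f y.
Proof.
move=> f0.
rewrite (fsbig_ord _ _ (fun i => \esum_(h in hits (p i)) f (act h (p i)))).
rewrite -esum_fset//; last first.
  by move=> i _; apply: esum_ge0 => h [Yh _]; exact: f0.
rewrite esum_esum; last by move=> i h _ [Yh _]; exact: f0.
apply/esym/(@reindex_esum _ _ _ _ _ (fun k => act k.2 (p k.1))).
split.
- by move=> [i h] [/= _ []].
- move=> [i h] [j h']; rewrite !inE => -[/= iM [_ h01]] [/= jM [_ h01']] ij.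
  move: h01 h01'; rewrite /= !in_itv/= => h01 h01'.
  have ? := family_disjoint fam iM jM ij; subst j.
  congr pair; rewrite -(fpart_id h01) -(fpart_id h01').
  by rewrite -(family_phaseE fam i) ij (family_phaseE fam i).
- move=> y Yy; have [i /= iM [t _ ty]] := subY Yy.
  exists (i, fpart t) => /=; last by rewrite act_fpart.
  split => //; split; first by rewrite /hitting_set/= act_fpart ty.
  by rewrite /= in_itv/= fpart_ge0 fpart_lt1.
Qed.

Section integral.
Variables (f : Z -> \bar R) (w : R -> \bar R).
Hypothesis f0 : forall y, Y y -> 0 <= f y.
Hypothesis mw : measurable_fun [set: R] w.
Hypothesis w0 : forall g, 0 <= w g.

Let Phi z := \esum_(g in hitting_set act Y z) (f (act g z) * w g).

Let Phi_ge0 z : 0 <= Phi z.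
Proof. by apply: esum_ge0 => g Yg; rewrite mule_ge0// f0. Qed.

(* Contribution of the visit h to the sum Phi (act t (p i)); it is set to 0 when
   h is not a visit, so that it is measurable in t for every h. *)
Let K i h t := if h \in hits (p i) then
  \esum_(n in [set: int]) (f (act h (p i)) * w (h + n%:~R - t)%R) else 0.

Let K_ge0 i h t : 0 <= K i h t.
Proof.
rewrite /K; case: ifPn => // /set_mem[Yh _].
by apply: esum_ge0 => n _; rewrite mule_ge0// f0.
Qed.

Let G i t := \sum_(h \in hits (p i)) K i h t.

Let PhiE i t : Phi (act t (p i)) = G i t.
Proof.
rewrite /Phi esum_hitting_set// esum_fset; last 2 first.
- exact: finite_hits.
- by move=> h Hh; have := K_ge0 i h t; rewrite /K Hh.
by apply: eq_fsbigr => h Hh; rewrite /K Hh.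
Qed.

Let unfold_hit i h : h \in hits (p i) ->
  measurable_fun [set: R] (K i h) /\
  \int[lebesgue_measure]_(t in I01) K i h t =
  f (act h (p i)) * \int[lebesgue_measure]_t w t.
Proof.
move=> Hh; have [Yh _] := set_mem Hh.
rewrite /K Hh -ge0_integralZl//; last exact: f0.
apply: (lebesgue_unfolding (w := fun t => f (act h (p i)) * w t) h).
  exact: measurable_funeM.
by move=> t; rewrite mule_ge0// f0.
Qed.

Let mK i h : measurable_fun [set: R] (K i h).
Proof.
have [/unfold_hit[]//|Hh] := boolP (h \in hits (p i)).
by rewrite /K (negbTE Hh).
Qed.

Let mG i : measurable_fun [set: R] (G i).
Proof.
rewrite (_ : G i = fun t =>
    \sum_(h <- finmap.enum_fset (fset_set (hits (p i)))) K i h t).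
  exact: emeasurable_sum.
by apply/funext => t; rewrite /G fsbig_finite//; exact: finite_hits.
Qed.

(** On each orbit the sum is a measurable function of the phase, and outside the
    union of the orbits it is an empty sum. *)
Lemma measurable_transverse_sum : measurable_fun [set: Z] Phi.
Proof.
pose E i := if (i < M)%N then range (act^~ (p i)) else set0.
have mE i : measurable (E i).
  by rewrite /E; case: ifP => // _; exact: family_orbit fam i.
have mUE : measurable (\bigcup_i E i) by exact: bigcupT_measurable.
rewrite -(setUv (\bigcup_i E i)); apply/measurable_funU => //.
  exact: measurableC.
split.
  apply/measurable_fun_bigcup => // i.
  apply: (@eq_measurable_fun _ _ _ _ _ (G i \o tau)).
    move=> z; rewrite inE /E; case: ifP => // _ [t _ <-] /=.
    by rewrite -PhiE act_phase.
  exact/measurable_funTS/(measurableT_comp (mG i) (family_phase fam)).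
apply: (@eq_measurable_fun _ _ _ _ _ (cst 0)) => // z.
rewrite inE => NEz; rewrite /Phi (_ : hitting_set act Y z = set0) ?esum_set0//.
rewrite -subset0 => g Yg; apply: NEz.
have [|i iM iz] := @hitting_set_orbit z; first by exists g.
by exists i => //; rewrite /E iM.
Qed.

(** Each visit to Y contributes the integral of w over the line, by unfolding. *)
Lemma integral_transverse_sum (m : {measure set Z -> \bar R}) :
  (forall A, measurable A -> m A =
    \sum_(i < M) lebesgue_measure ((act^~ (p i)) @^-1` A `&` I01)) ->
  \int[m]_z Phi z = \esum_(y in Y) (f y * \int[lebesgue_measure]_t w t).
Proof.
move=> mE; rewrite (eq_measure_integral
  (sum_probability (fun i => curve_measure (family_curve fam i)) M)); last first.
  by move=> A mA _; rewrite mE.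
rewrite ge0_integral_sum_probability//; last exact: measurable_transverse_sum.
rewrite -esum_orbits; last first.
  by move=> y Yy; rewrite mule_ge0//; [exact: f0|exact: integral_ge0].
apply: eq_bigr => i _; rewrite ge0_integral_curve//; last first.
  exact: measurable_transverse_sum.
under eq_integral do rewrite PhiE.
rewrite ge0_integral_fsum//; last 2 first.
- by move=> h; exact: measurable_funS (mK i h).
- exact: finite_hits.
rewrite esum_fset; last 2 first.
- exact: finite_hits.
- move=> h /set_mem[Yh _]; rewrite mule_ge0//; [exact: f0|exact: integral_ge0].
by apply: eq_fsbigr => h /unfold_hit[].
Qed.

End integral.

Lemma saturation_orbits : (forall i, (i < M)%N -> hits (p i) !=set0) ->
  saturation act Y = \bigcup_(i < M) range (act^~ (p i)).
Proof.
move=> Y0; apply/seteqP; split => [z [g [y [Yy ->]]]|z [i /= iM [t _ <-]]].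
  have [|i iM iz] := @hitting_set_orbit (act g y); last by exists i.
  exists (- g)%R; rewrite /hitting_set/= -(family_actD fam) addNr.
  by rewrite (family_act0 fam).
have [h [Yh _]] := Y0 i iM; exists (t - h)%R, (act h (p i)); split => //.
by rewrite -(family_actD fam) subrK.
Qed.

Lemma measurable_orbits : measurable (\bigcup_(i < M) range (act^~ (p i))).
Proof. by apply: bigcup_measurable => i _; exact: family_orbit fam i. Qed.

Section orbit_union_measure.
Variable m : {measure set Z -> \bar R}.
Hypothesis mE : forall A, measurable A -> m A =
  \sum_(i < M) lebesgue_measure ((act^~ (p i)) @^-1` A `&` I01).

(** The transverse measure is the counting measure on Y: a visit is weighted by
    the total mass of w, which is 1. The measure nu enters through its integrals,
    which is how a product of chosen transverse measures is known. *)
Lemma transverse_measure_orbits (nu : {measure set Z -> \bar R}) :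
  nu (~` Y) = 0 ->
  (forall f, measurable_fun Y f -> (forall y, Y y -> 0 <= f y) ->
    \int[nu]_(y in Y) f y = \esum_(y in Y) f y) ->
  is_transverse_measure act m Y nu.
Proof.
move=> nuY nuE; split => // w mw w0 w1 f mf f0.
rewrite nuE// integral_transverse_sum//.
by apply: eq_esum => y _; rewrite w1 mule1.
Qed.

Lemma invariant_orbits : (forall g, measurable_fun [set: Z] (act g)) ->
  invariant_measure act m.
Proof.
move=> mact g A mA.
have mpre d1 d2 (T1 : measurableType d1) (T2 : measurableType d2)
    (k : T1 -> T2) B : measurable_fun [set: T1] k -> measurable B ->
    measurable (k @^-1` B).
  by move=> mk mB; rewrite -[X in measurable X]setTI; exact: mk.
rewrite !mE//; last exact: mpre.
apply: eq_bigr => i _.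
rewrite -(@lebesgue_measure_periodic _ ((act^~ (p i)) @^-1` A) g).
- congr lebesgue_measure; apply/seteqP; split => t /=;
    by rewrite (family_actD fam).
- by apply: mpre => //; exact: family_curve fam i.
- by move=> t n /=; rewrite (family_actD fam) act_int.
Qed.

End orbit_union_measure.

(** The mass of G.Y is a function of the transverse measure alone. Take a set T
    with one point on each orbit as test set, and the indicator of [0, 1) as
    weight: every point of G.Y meets T exactly once within a unit of time, so
    the transverse sum is the indicator of G.Y and the mass is the number of
    points of T. *)
Lemma saturation_mass (m nu : {measure set Z -> \bar R}) :
  (forall i, (i < M)%N -> hits (p i) !=set0) ->
  measurable Y ->
  is_transverse_measure act m Y nu ->
  (forall f, measurable_fun Y f -> (forall y, Y y -> 0 <= f y) ->
    \int[nu]_(y in Y) f y = \esum_(y in Y) f y) ->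
  m (saturation act Y) = M%:R%:E.
Proof.
move=> Y0 mY [_ mnu] nuE.
pose h i := xget 0%R (hits (p i)).
have hH i : (i < M)%N -> hits (p i) (h i).
  by move=> /Y0[x Hx]; rewrite /h; case: xgetP => [//|/(_ x)].
pose T := \bigcup_(i < M) (range (act^~ (p i)) `&` tau @^-1` [set h i]).
have mT : measurable T.
  apply: bigcup_measurable => i _; apply: measurableI.
    exact: family_orbit fam i.
  by rewrite -[X in measurable X]setTI; exact: (family_phase fam).
have TE i t : (i < M)%N -> T (act t (p i)) = (fpart t = h i).
  move=> iM; apply/propext; split.
    move=> [j /= jM [[s _ sj]]]; have ? := family_disjoint fam jM iM sj; subst j.
    by rewrite /= (family_phaseE fam).
  move=> ti; exists i => //; split; first by exists t.
  by rewrite /= (family_phaseE fam).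
pose f (z : Z) : \bar R := (\1_T z)%:E.
pose w (g : R) : \bar R := (\1_I01 g)%:E.
have mw : measurable_fun [set: R] w by exact/measurable_EFinP.
have w0 g : 0 <= w g by rewrite lee_fin.
have w1 : \int[lebesgue_measure]_g w g = 1.
  by rewrite integral_indic//= setIT lebesgue_measure01.
have mf : measurable_fun Y f.
  by apply: measurable_funTS; apply/measurable_EFinP; exact: measurable_indic.
have f0 y : 0 <= f y by rewrite lee_fin.
have msat : measurable (saturation act Y).
  by rewrite saturation_orbits//; exact: measurable_orbits.
transitivity (\int[m]_z (\1_(saturation act Y) z)%:E).
  by rewrite integral_indic// setIT.
transitivity (\int[m]_z \esum_(g in hitting_set act Y z) (f (act g z) * w g)).
  apply: eq_integral => z _.
  have [sz|nsz] := pselect (saturation act Y z); last first.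
    rewrite indicE memNset// (_ : hitting_set act Y z = set0) ?esum_set0//.
    rewrite -subset0 => g Yg; apply: nsz; exists (- g)%R, (act g z).
    by rewrite -(family_actD fam) addNr (family_act0 fam).
  rewrite indicE mem_set//.
  move: sz; rewrite saturation_orbits// => -[i /= iM [t _ <-{z}]].
  have [Yh h01] := hH i iM.
  have hE : fpart (h i) = h i by rewrite fpart_id//; move: h01; rewrite /= in_itv.
  pose g0 := fpart (h i - t)%R.
  have g0I : I01 g0 by rewrite /= in_itv/= fpart_ge0 fpart_lt1.
  have g0E : act g0 (act t (p i)) = act (h i) (p i).
    by rewrite -(family_actD fam) -act_fpart fpartDl subrK act_fpart.
  rewrite (@esum_only _ _ _ _ g0).
  - by rewrite /f /w g0E !indicE !mem_set ?mule1// TE.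
  - by rewrite /hitting_set/= g0E.
  - by rewrite mule_ge0.
  move=> g Yg gg0; rewrite /f /w !indicE.
  have [/set_mem g01|] := boolP (g \in I01); last by rewrite mule0.
  have [/set_mem|] := boolP (act g (act t (p i)) \in T); last by rewrite mul0e.
  rewrite -(family_actD fam) TE// => gth; exfalso; apply: gg0.
  rewrite /g0 -gth.
  have -> : fpart (fpart (g + t) - t)%R = fpart g by rewrite fpartDl addrK.
  by rewrite fpart_id//; move: g01; rewrite /= in_itv.
rewrite -mnu// nuE//.
rewrite -esum_orbits// (eq_bigr (fun=> 1)).
  by rewrite sumEFin sumr_const card_ord.
move=> i _; have [Yh h01] := hH i (ltn_ord i).
have fparth x : I01 x -> fpart x = x.
  by rewrite /= in_itv/= => ?; rewrite fpart_id.
rewrite (@esum_only _ _ _ _ (h i)) //.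
  by rewrite /f indicE mem_set// TE// fparth.
by move=> x [Yx x01] xh; rewrite /f indicE memNset// TE// fparth.
Qed.

End orbit_family.

(** * Counting measure on a finite set of points *)

Lemma counting_esum (R : realType) (T : choiceType) (A : set T) :
  finite_set A -> counting A = \esum_(x in A) 1 :> \bar R.
Proof.
move=> fA; rewrite /counting asboolT// esum_fset//.
rewrite fsbig_finite//= sumEFin big_const_seq count_predT.
by rewrite -Monoid.iteropE /=; congr _%:E; rewrite iter_addr addr0.
Qed.

Section counting_on_finite_set.
Context (R : realType) d (T : measurableType d) (M : nat) (pt : nat -> T).
Hypothesis pt_inj : {in `I_M &, injective pt}.
Local Notation Y := (pt @` `I_M).

Definition points_measure : {finite_measure set T -> \bar R} :=
  sum_probability (fun j => \d_(pt j)) M.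

Lemma sum_points (f : T -> \bar R) : (forall y, Y y -> 0 <= f y) ->
  \sum_(j < M) f (pt j) = \esum_(y in Y) f y.
Proof.
move=> f0; rewrite (fsbig_ord _ _ (f \o pt)) -esum_fset//; last first.
  by move=> j jM; apply: f0; exists j => //; exact: set_mem.
by apply/esym/(@reindex_esum _ _ _ _ _ pt); split.
Qed.

Lemma integral_points (f : T -> \bar R) :
  measurable_fun [set: T] f -> (forall x, 0 <= f x) ->
  \int[points_measure]_x f x = \sum_(j < M) f (pt j).
Proof.
move=> mf f0; rewrite ge0_integral_sum_probability//.
by apply: eq_bigr => j _; rewrite integral_dirac// diracT mul1e.
Qed.

Lemma points_measureE A : points_measure A = \sum_(j < M) \d_(pt j) A.
Proof. by []. Qed.

Lemma points_measureC : points_measure (~` Y) = 0.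
Proof.
rewrite points_measureE big1// => j _; rewrite diracE memNset// => nY.
by apply: nY; exists (j : nat) => //=.
Qed.

Lemma points_measure_mass : points_measure Y = M%:R%:E.
Proof.
rewrite points_measureE (eq_bigr (fun=> 1)).
  by rewrite sumEFin sumr_const card_ord.
by move=> j _; rewrite diracE mem_set//; exists (j : nat) => /=.
Qed.

Lemma integral_points_esum (f : T -> \bar R) : measurable Y ->
  measurable_fun Y f -> (forall y, Y y -> 0 <= f y) ->
  \int[points_measure]_(y in Y) f y = \esum_(y in Y) f y.
Proof.
move=> mY mf f0; rewrite integral_mkcond integral_points.
- rewrite sum_points; last by move=> y Yy; rewrite patchT ?inE//; exact: f0.
  by apply: eq_esum => y Yy; rewrite patchT ?inE.
- exact/(measurable_restrictT f mY).
- by move=> x; rewrite /patch; case: ifPn => // /set_mem; exact: f0.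
Qed.

End counting_on_finite_set.

(** * Uniqueness of the transverse measure *)

Section transverse_uniqueness.
Context (R : realType) d (X : measurableType d) (act : R -> X -> X).
Variables (mu : {measure set X -> \bar R}) (Y : set X).
Hypothesis mY : measurable Y.

(** Testing against indicators, with the indicator of [0, 1) as weight. The two
    measures may still differ on non-measurable sets. *)
Lemma transverse_measure_unique (nu nu' : {measure set X -> \bar R}) :
  is_transverse_measure act mu Y nu -> is_transverse_measure act mu Y nu' ->
  forall A, measurable A -> nu A = nu' A.
Proof.
move=> [nuY nuE] [nuY' nuE'] A mA.
have mass (n : {measure set X -> \bar R}) : n (~` Y) = 0 ->
    n A = \int[n]_(y in Y) (\1_A y)%:E.
  move=> nY; rewrite integral_indic// (measureDI n mA mY).
  rewrite [X in X + _](_ : _ = 0) ?add0e//.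
  apply: subset_measure0 nY; [exact: measurableD|exact: measurableC|].
  by move=> x [].
rewrite (mass nu nuY) (mass nu' nuY').
pose w (g : R) : \bar R := (\1_I01 g)%:E.
have mw : measurable_fun [set: R] w by exact/measurable_EFinP.
have w0 g : 0 <= w g by rewrite lee_fin.
have w1 : \int[lebesgue_measure]_g w g = 1.
  by rewrite integral_indic//= setIT lebesgue_measure01.
have mf : measurable_fun Y (fun y => (\1_A y)%:E : \bar R).
  by apply: measurable_funTS; apply/measurable_EFinP; exact: measurable_indic.
have f0 y : Y y -> 0 <= (\1_A y)%:E :> \bar R by rewrite lee_fin.
by rewrite (nuE w)// (nuE' w).
Qed.

Lemma transverse_measureP (nu : {sigma_finite_measure set X -> \bar R}) :
  is_transverse_measure act mu Y nu ->
  is_transverse_measure act mu Y (transverse_measure act mu Y) /\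
  forall A, measurable A -> transverse_measure act mu Y A = nu A.
Proof.
move=> nuP.
have P : is_transverse_measure act mu Y (transverse_measure act mu Y).
  exact: (@xgetPex {classic {sigma_finite_measure set X -> \bar R}} mzero
    [set nu | is_transverse_measure act mu Y nu] (ex_intro _ nu nuP)).
by split => // A mA; exact: transverse_measure_unique.
Qed.

End transverse_uniqueness.

(** * The circle *)

Section circle.
Context (R : realType).

(** Every interval [n, n+1) is a circle on which R acts by rotations. *)
Definition rotation (g x : R) : R := ((Num.floor x)%:~R + fpart (x + g))%R.

Lemma floor_rotation g x : Num.floor (rotation g x) = Num.floor x.
Proof.
by rewrite /rotation addrC floorDint floor_fpart add0r.
Qed.

Lemma rotation0 x : rotation 0%R x = x.
Proof. by rewrite /rotation addr0 addrC -fpart_floor. Qed.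

Lemma rotationD g h x : rotation (g + h)%R x = rotation g (rotation h x).
Proof.
rewrite {2}/rotation floor_rotation /rotation; congr (_ + _)%R.
by rewrite -[in RHS]addrA [in RHS]addrC fpartDint fpartDl -addrA (addrC h).
Qed.

Lemma rotation1 x : rotation 1%R x = x.
Proof.
rewrite -[RHS]rotation0 /rotation addr0; congr (_ + _)%R.
exact: (fpartDint x 1).
Qed.

Lemma rotation_id g x : I01 x -> rotation g x = fpart (x + g).
Proof. by rewrite floor0E /rotation => /= ->; rewrite add0r. Qed.

Lemma measurable_rotation :
  measurable_fun [set: R * R] (fun q => rotation q.1 q.2).
Proof.
apply: measurable_funD.
  by apply: (measurableT_comp (measurable_floor measurableT)) measurable_snd.
apply: (measurableT_comp (measurable_fpart measurableT)).
exact: measurable_funD.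
Qed.

Lemma measurable_rotation_l g : measurable_fun [set: R] (rotation g).
Proof.
apply: measurable_funD; first exact: measurable_floor.
apply: (measurableT_comp (measurable_fpart measurableT)).
exact: measurable_funD.
Qed.

Lemma measurable_rotation_r x : measurable_fun [set: R] (rotation^~ x).
Proof.
apply: measurable_funD => //.
apply: (measurableT_comp (measurable_fpart measurableT)).
exact: measurable_funD.
Qed.

Lemma standard_borel_real : standard_borel R R.
Proof.
exists R, id; split.
- exact: Rhausdorff.
- exists (range (ratr : rat -> R)); last exact: dense_rat.
  by apply: sub_countable (card_image_le _ _) _; exact: countableP.
- by exists id.
- move=> A; rewrite image_id; split => [mA|].
    have : (@RGenOpens.G R).-sigma.-measurable A by rewrite -RGenOpens.measurableE.
    apply: smallest_sub; first exact: smallest_sigma_algebra.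
    by move=> _ [x [y ->]]; apply: sub_sigma_algebra; exact: interval_open.
  apply: smallest_sub; last exact: open_measurable.
  exact: sigma_algebra_measurable.
Qed.

Lemma rotation_borel : borel_space rotation.
Proof.
split; [exact: standard_borel_real|exact: rotation0|exact: rotationD|].
exact: measurable_rotation.
Qed.

Lemma rotation_origin t : rotation t 0%R = fpart t.
Proof. by rewrite rotation_id ?add0r//= in_itv/= lexx ltr01. Qed.

Definition circle_measure : probability R R :=
  curve_measure (measurable_rotation_r 0%R).

Lemma rotation_family :
  orbit_family rotation 1 (fun=> 0%R) (@fpart R).
Proof.
split.
- exact: rotation0.
- exact: rotationD.
- exact: rotation1.
- by move=> _; exact: measurable_rotation_r.
- exact: measurable_fpart.
- by move=> _ t; rewrite rotation_origin fpartK.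
- move=> _; suff -> : range (rotation^~ 0%R) = I01 by exact: measurable_itv.
  apply/seteqP; split => [_ [t _ <-]|t] /=.
    by rewrite rotation_origin in_itv/= fpart_ge0 fpart_lt1.
  by rewrite in_itv/= => t01; exists t => //; rewrite rotation_origin fpart_id.
- by move=> [|i] [|j].
Qed.

Lemma circle_measureE A : circle_measure A =
  \sum_(i < 1) lebesgue_measure ((rotation^~ 0%R) @^-1` A `&` I01).
Proof. by rewrite big_ord1. Qed.

(** The measure lives on the single orbit [0, 1), which an invariant set contains
    or avoids. *)
Lemma circle_ergodic : ergodic rotation circle_measure.
Proof.
move=> A mA invA.
have rotA t : A (rotation t 0%R) = A 0%R.
  by rewrite -{2}(invA t).
have [A0|A0] := pselect (A 0%R); [right|left];
  rewrite /circle_measure /= curve_measureE.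
- rewrite (_ : _ `&` _ = set0) ?measure0// -subset0 => t [/= nA _].
  by apply: nA; rewrite rotA.
- rewrite (_ : _ `&` _ = set0) ?measure0// -subset0 => t [/= nA _].
  by apply: A0; rewrite -(rotA t).
Qed.

End circle.

(** * The cyclic group of order m+1 with one point removed *)

Section punctured_grid.
Context (R : realType) (m : nat).
Hypothesis m_gt1 : (1 < m)%N.
Local Notation rot := (@rotation R).

(** The point 0 of the subgroup is left out: the indices j < m give
    the points from 1/(m+1) to m/(m+1). *)
Definition grid (j : nat) : R := (j.+1%:R / m.+1%:R)%R.

Definition punctured_grid : set R := grid @` `I_m.
Local Notation Y := punctured_grid.

Lemma grid01 j : (j < m)%N -> (0 <= grid j < 1)%R.
Proof.
move=> jm; rewrite /grid divr_ge0//= ltr_pdivrMr ?ltr0n// mul1r ltr_nat.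
by rewrite ltnS.
Qed.

Lemma grid_inj : {in `I_m &, injective grid}.
Proof.
move=> i j _ _ /(mulIf _) ij; apply: succn_inj; apply/eqP.
by rewrite -(eqr_nat R); apply/eqP/ij; rewrite invr_eq0 pnatr_eq0.
Qed.

Lemma finite_grid : finite_set Y.
Proof. exact: finite_image. Qed.

Lemma measurable_grid : measurable Y.
Proof.
rewrite (_ : Y = \bigcup_(j < m) [set grid j]).
  by apply: bigcup_measurable => j _; exact: measurable_set1.
apply/seteqP; split => [_ [j jm <-]|_ [j jm ->]]; first by exists j.
by exists j.
Qed.

Lemma grid_orbit : Y `<=` \bigcup_(i < 1) range (rot^~ (0%R : R)).
Proof.
move=> _ [j /= jm <-]; exists 0%N => //; exists (grid j) => //.
by rewrite rotation_origin fpart_id// grid01.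
Qed.

Lemma grid_hits i : (i < 1)%N -> hits rot Y 0%R !=set0.
Proof.
move=> _; have m0 : (0 < m)%N by exact: ltn_trans m_gt1.
exists (grid 0%N); split; last by rewrite /= in_itv/= grid01.
by rewrite /hitting_set/= rotation_origin fpart_id ?grid01//; exists 0%N.
Qed.

Lemma saturation_grid : saturation rot Y = I01.
Proof.
rewrite (saturation_orbits (rotation_family R) grid_orbit grid_hits).
apply/seteqP; split => [x [i _ [t _ <-]]|x x01]; rewrite /= ?in_itv/=.
  by rewrite rotation_origin fpart_ge0 fpart_lt1.
by exists 0%N => //=; exists x => //; rewrite rotation_origin fpart_id.
Qed.

(** A visiting time is determined by the point of Y that is reached and by the
    number of full turns, and both are bounded on a compact set. *)
Lemma grid_locally_finite x K : compact K ->
  finite_set (hitting_set rot Y x `&` K).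
Proof.
move=> /compact_bounded[c [_ /(_ (`|c| + 1)%R)]].
rewrite (le_lt_trans (ler_norm c)) ?ltrDl// => /(_ isT) Kb.
set B := (`|c| + 1)%R in Kb.
pose b := (Num.truncn (`|x| + B)%R).+1.
have xBb : (`|x| + B < b%:R)%R by exact: truncnS_gt.
(* The number of turns lies in [- b, b) and is shifted by b to index by nat. *)
pose f (q : nat * nat) : R := (grid q.1 + q.2%:R - b%:R - x)%R.
apply: (@sub_finite_set _ _ (f @` (`I_m `*` `I_(b + b)))); last first.
  by apply: finite_image; exact: finite_setX.
move=> g [[j jm jg] Kg].
have fx0 : Num.floor x = 0%R.
  rewrite -(floor_rotation g) -jg; apply: floor_def.
  by rewrite add0r grid01.
have xg : (grid j = fpart (x + g))%R by rewrite jg /rotation fx0 add0r.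
have gB : (`|g| <= B)%R by exact: Kb.
have xgb : (`|(x + g)%R| < b%:R)%R.
  by apply: le_lt_trans xBb; apply: (le_trans (ler_normD _ _)); rewrite lerD2l.
pose n := Num.floor (x + g)%R.
have /andP[n1 n2] : (n%:~R <= x + g < (n + 1)%:~R)%R by exact: floor_itv.
move: xgb; rewrite ltr_norml => /andP[b1 b2].
have nb1 : (0 <= n + b%:Z)%R.
  have : (- b%:Z < n + 1)%R.
    by rewrite -(ltr_int R) intrN -pmulrn (lt_trans b1).
  by rewrite -subr_gt0; lia.
have nb2 : (n < b%:Z)%R by rewrite -(ltr_int R) -pmulrn (le_lt_trans n1).
exists (j, `|(n + b%:Z)%R|%N).
  by split => //=; lia.
rewrite /f /= xg -[X in (_ + X - _ - _)%R]/(_%:R) pmulrn gez0_abs//.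
by rewrite intrD -pmulrn /fpart -/n; ring.
Qed.

(** The integrability condition is the unfolding formula for the constant
    function 1, with the indicator of K as weight. *)
Lemma circle_transverse_space : transverse_space rot (circle_measure R) Y.
Proof.
have mact g : measurable_fun [set: R] (rot g).
  exact: measurable_rotation_l.
have fam := rotation_family R.
split.
- exact: rotation_borel.
- by apply: (invariant_orbits fam) => // A mA; exact: circle_measureE.
- exact: measurable_grid.
- by rewrite saturation_grid; exact: measurable_itv.
- rewrite saturation_grid /circle_measure /= curve_measureE (_ : _ `&` _ = set0) ?measure0//.
  rewrite -subset0 => t [/= nt t01]; by apply: nt; rewrite rotation_origin fpart_id.
- by move=> x _ K; exact: grid_locally_finite.
move=> K cK; have mK := compact_measurable cK.
pose w (g : R) : \bar R := (\1_K g)%:E.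
have mw : measurable_fun [set: R] w by exact/measurable_EFinP.
have w0 g : 0 <= w g by rewrite lee_fin.
rewrite (eq_integral (fun x => \esum_(g in hitting_set rot Y x)
    (cst 1 (rot g x) * w g))); last first.
  move=> x _; rewrite counting_esum; last exact: grid_locally_finite.
  rewrite esum_mkcondr; apply: eq_esum => g _.
  by rewrite mul1e /w indicE; case: (g \in K).
rewrite (integral_transverse_sum fam finite_grid grid_orbit _ mw w0)//; last first.
  by move=> A _; exact: circle_measureE.
rewrite integral_indic// setIT esum_fset; last 2 first.
- exact: finite_grid.
- by move=> y _; rewrite mul1e.
rewrite fsbig_finite; last exact: finite_grid.
by apply: lte_sum_pinfty => y _; rewrite mul1e; exact: compact_finite_measure.
Qed.

Lemma grid_transverse_measure :
  is_transverse_measure rot (circle_measure R) Y (points_measure R m grid).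
Proof.
apply: (transverse_measure_orbits (rotation_family R) finite_grid grid_orbit).
- by move=> A _; exact: circle_measureE.
- exact: points_measureC.
- move=> f mf f0; apply: integral_points_esum => //; first exact: grid_inj.
  exact: measurable_grid.
Qed.

Lemma transverse_measure_grid A : measurable A ->
  transverse_measure rot (circle_measure R) Y A = points_measure R m grid A.
Proof.
by have [_] := transverse_measureP measurable_grid grid_transverse_measure; apply.
Qed.

Lemma intensity_grid : intensity rot (circle_measure R) Y = m%:R%:E.
Proof.
rewrite /intensity transverse_measure_grid; last exact: measurable_grid.
exact: points_measure_mass.
Qed.

Local Notation rot2 := (diagonal_action rot).

(** * Pairs of points of the circle *)

(** The base point of the orbit of pairs with difference i/(m+1). The fractional
    part keeps it in the square [0, 1) x [0, 1) for i > m as well. *)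
Definition pair_base (i : nat) : R * R := (0%R, fpart (i%:R / m.+1%:R)%R).

Lemma rotation_pair t i :
  rot2 t (pair_base i) = (fpart t, fpart (t + i%:R / m.+1%:R)%R).
Proof.
rewrite /diagonal_action/= rotation_origin rotation_id ?fpartDl 1?addrC//.
by rewrite /= in_itv/= fpart_ge0 fpart_lt1.
Qed.

Lemma measurable_pair_orbit i : measurable_fun [set: R] (rot2^~ (pair_base i)).
Proof.
rewrite (_ : (fun t => _) = fun t => (fpart t, fpart (t + i%:R / m.+1%:R)%R)).
  apply: measurable_fun_pair; first exact: measurable_fpart.
  apply: (measurableT_comp (measurable_fpart measurableT)).
  exact: measurable_funD.
by apply/funext => t; exact: rotation_pair.
Qed.

Lemma fpart_ratio_inj i j : (i < m.+1)%N -> (j < m.+1)%N ->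
  fpart (i%:R / m.+1%:R : R)%R = fpart (j%:R / m.+1%:R)%R -> i = j.
Proof.
move=> iN jN; rewrite !fpart_id.
- move/mulIf => /(_ _)/eqP; rewrite eqr_nat => /(_ _)/eqP; apply.
  by rewrite invr_eq0 pnatr_eq0.
- by rewrite divr_ge0//= ltr_pdivrMr ?ltr0n// mul1r ltr_nat.
- by rewrite divr_ge0//= ltr_pdivrMr ?ltr0n// mul1r ltr_nat.
Qed.

Lemma pair_family : orbit_family rot2 m.+1 pair_base (fun z => fpart z.1).
Proof.
split.
- by move=> [x y]; rewrite /diagonal_action/= !rotation0.
- by move=> g h [x y]; rewrite /diagonal_action/= !rotationD.
- by move=> [x y]; rewrite /diagonal_action/= !rotation1.
- exact: measurable_pair_orbit.
- exact: (measurableT_comp (measurable_fpart measurableT)) measurable_fst.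
- by move=> i t; rewrite rotation_pair/= fpartK.
- move=> i; pose c : R := (i%:R / m.+1%:R)%R.
  suff -> : range (rot2^~ (pair_base i)) =
      (fst @^-1` I01) `&` (fun z => z.2 - fpart (z.1 + c))%R @^-1` [set 0%R].
    apply: measurableI.
      rewrite -[X in measurable X]setTI.
      by apply: measurable_fst => //; exact: measurable_itv.
    rewrite -[X in measurable X]setTI; apply: measurable_funB => //.
    apply: (measurableT_comp (measurable_fpart measurableT)).
    exact: measurable_funD.
  apply/seteqP; split => [_ [t _ <-]|[x y] [/=]].
    rewrite rotation_pair/= fpartDl subrr; split => //.
    by rewrite in_itv/= fpart_ge0 fpart_lt1.
  rewrite in_itv/= => x01 /subr0_eq ->; exists x => //.
  by rewrite rotation_pair fpart_id.
- move=> i j s t iN jN; rewrite !rotation_pair => -[st].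
  rewrite -[in LHS]fpartDl st fpartDl => ij; apply: fpart_ratio_inj => //.
  have shift a : fpart a = fpart (fpart (t + a) - t)%R.
    by rewrite fpartDl (addrC t) addrK.
  by rewrite (shift (i%:R / _)%R) ij -shift.
Qed.

Lemma grid_pair_orbit :
  Y `*` Y `<=` \bigcup_(i < m.+1) range (rot2^~ (pair_base i)).
Proof.
move=> [_ _] [/= [a /= am <-] [b /= bm <-]].
have [ab|ba] := leqP a b.
  exists (b - a)%N => /=; first by lia.
  exists (grid a) => //; rewrite rotation_pair fpart_id ?grid01//.
  congr pair; rewrite (_ : _ + _ = grid b)%R ?fpart_id ?grid01//.
  by rewrite /grid -mulrDl -natrD; congr (_%:R / _)%R; lia.
exists (b + m.+1 - a)%N => /=; first by lia.
exists (grid a) => //; rewrite rotation_pair fpart_id ?grid01//.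
congr pair; rewrite (_ : _ + _ = grid b + 1%:~R)%R.
  by rewrite fpartDint fpart_id ?grid01.
rewrite /grid -mulrDl -natrD -[1%:~R]/(1%R).
rewrite -[X in (_ + X)%R](@divff _ (m.+1%:R : R)%R) ?pnatr_eq0//.
by rewrite -mulrDl -natrD; congr (_%:R / _)%R; lia.
Qed.

(** Every element of the subgroup is a difference of two points of Y. The
    difference i/(m+1) with i < m is realized by a pair starting at 1/(m+1), and
    the difference m/(m+1) by the pair of 2/(m+1) and 1/(m+1); having both of
    these points in Y takes m > 1. *)
Lemma pair_hits i : (i < m.+1)%N -> hits rot2 (Y `*` Y) (pair_base i) !=set0.
Proof.
rewrite ltnS leq_eqVlt => /orP[/eqP->|im].
  exists (grid 1); split; last by rewrite /= in_itv/= grid01.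
  rewrite /hitting_set /mkset rotation_pair fpart_id ?grid01//.
  split => /=; first by exists 1%N.
  exists 0%N => /=; first by lia.
  rewrite (_ : _ + _ = grid 0 + 1%:~R)%R; last first.
    rewrite /grid -mulrDl -natrD -[1%:~R]/(1%R).
    rewrite -[X in (_ + X)%R](@divff _ (m.+1%:R : R)%R) ?pnatr_eq0//.
    by rewrite -mulrDl -natrD; congr (_%:R / _)%R; lia.
  by rewrite fpartDint fpart_id ?grid01//; lia.
have m0 : (0 < m)%N by lia.
exists (grid 0); split; last by rewrite /= in_itv/= grid01.
rewrite /hitting_set /mkset rotation_pair fpart_id ?grid01//.
split => /=; first by exists 0%N.
exists i => //; rewrite (_ : _ + _ = grid i)%R ?fpart_id ?grid01//.
by rewrite /grid -mulrDl -natrD; congr (_%:R / _)%R; lia.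
Qed.

Lemma intersection_space_grid :
  intersection_space rot Y = saturation rot2 (Y `*` Y).
Proof.
apply/seteqP; split => [z [g [y1 [y2 [Y1 Y2 ->]]]]|z [g [[y1 y2] [[Y1 Y2] ->]]]].
  by exists g, (y1, y2).
by exists g, y1, y2.
Qed.

Definition pair_measure : {finite_measure set (R * R)%type -> \bar R} :=
  sum_probability (fun i => curve_measure (measurable_pair_orbit i)) m.+1.

Local Notation muY := (transverse_measure rot (circle_measure R) Y).

(** Integrals only depend on the values of a measure on measurable sets, so the
    chosen transverse measure integrates like the sum of point masses. *)
Lemma integral_transverse_grid (f : R -> \bar R) :
  measurable_fun [set: R] f -> (forall x, 0 <= f x) ->
  \int[muY]_x f x = \sum_(j < m) f (grid j).
Proof.
move=> mf f0; rewrite -integral_points//.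
by apply: eq_measure_integral => A mA _; exact: transverse_measure_grid.
Qed.

Lemma integral_transverse_grid2 (f : R * R -> \bar R) :
  measurable_fun [set: R * R] f -> (forall z, 0 <= f z) ->
  \int[muY \x muY]_z f z = \sum_(j < m) \sum_(k < m) f (grid j, grid k).
Proof.
move=> mf f0; rewrite fubini_tonelli1//.
have FE x : fubini_F muY f x = \sum_(k < m) f (x, grid k).
  rewrite /fubini_F (integral_transverse_grid (f := fun y => f (x, y)))//.
  exact: (measurableT_comp mf) (pair1_measurable x).
under eq_integral do rewrite FE.
rewrite integral_transverse_grid//.
- apply: emeasurable_sum => k.
  exact: (measurableT_comp mf) (pair2_measurable (grid k)).
- by move=> x; apply: sume_ge0.
Qed.

Lemma integral_transverse_grid2_esum (f : R * R -> \bar R) :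
  measurable_fun (Y `*` Y) f -> (forall z, (Y `*` Y) z -> 0 <= f z) ->
  \int[muY \x muY]_(z in Y `*` Y) f z = \esum_(z in Y `*` Y) f z.
Proof.
have mYY : measurable (Y `*` Y) by apply: measurableX; exact: measurable_grid.
move=> mf f0; rewrite integral_mkcond integral_transverse_grid2; last 2 first.
- exact/(measurable_restrictT f mYY).
- by move=> x; rewrite /patch; case: ifPn => // /set_mem; exact: f0.
have YYE j k : (j < m)%N -> (k < m)%N ->
    (f \_ (Y `*` Y)) (grid j, grid k) = f (grid j, grid k).
  by move=> jm km; rewrite patchT// inE; split; [exists j|exists k].
transitivity (\esum_(y1 in Y) \esum_(y2 in Y) f (y1, y2)).
  rewrite -(sum_points grid_inj (f := fun y1 => \esum_(y2 in Y) f (y1, y2))).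
    apply: eq_bigr => j _; rewrite -(sum_points grid_inj).
      by apply: eq_bigr => k _; rewrite YYE.
    by move=> y Yy; apply: f0; split => //; exists (j : nat) => /=.
  by move=> y Yy; apply: esum_ge0 => y2 Y2; exact: f0.
rewrite esum_esum; last by move=> y1 y2 Y1 Y2; exact: f0.
by apply: eq_esum => -[].
Qed.

Lemma pair_measureE A : pair_measure A =
  \sum_(i < m.+1) lebesgue_measure ((rot2^~ (pair_base i)) @^-1` A `&` I01).
Proof. by []. Qed.

Let finite_YY : finite_set (Y `*` Y).
Proof. by apply: finite_setX; exact: finite_grid. Qed.

Let measurable_YY : measurable (Y `*` Y).
Proof. by apply: measurableX; exact: measurable_grid. Qed.

Lemma grid_intersection_measure :
  is_intersection_measure rot (circle_measure R) Y pair_measure.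
Proof.
have mE A : measurable A -> pair_measure A = _ := fun _ => pair_measureE A.
split.
- rewrite intersection_space_grid.
  rewrite (saturation_orbits pair_family grid_pair_orbit pair_hits).
  apply: big1 => i _; rewrite /= curve_measureE.
  rewrite (_ : _ `&` _ = set0) ?measure0// -subset0 => t [/= nt _]; apply: nt.
  by exists (i : nat) => //=; exists t.
- apply: (invariant_orbits pair_family mE) => g.
  by apply: measurable_fun_pair;
    apply: (measurableT_comp (measurable_rotation_l g)).
- apply: (transverse_measure_orbits pair_family finite_YY grid_pair_orbit mE).
    transitivity (\int[muY \x muY]_z (\1_(~` (Y `*` Y)) z)%:E).
      by rewrite integral_indic ?setIT//; exact: measurableC.
    rewrite integral_transverse_grid2//.
    + rewrite big1// => j _; rewrite big1// => k _.
      rewrite indicE memNset//= => nYY; apply: nYY.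
      by split => /=; [exists (j : nat)|exists (k : nat)] => //=.
    + by apply/measurable_EFinP; apply: measurable_indic; exact: measurableC.
  exact: integral_transverse_grid2_esum.
Qed.

Lemma intersection_covolume_grid :
  intersection_covolume rot (circle_measure R) Y = m.+1%:R%:E.
Proof.
rewrite /intersection_covolume intersection_space_grid.
have [_ _ transverse] : is_intersection_measure rot (circle_measure R) Y
    (intersection_measure rot (circle_measure R) Y).
  exact: (@xgetPex {classic {sigma_finite_measure set (R * R)%type -> \bar R}} mzero
    [set mu2 | is_intersection_measure rot (circle_measure R) Y mu2]
    (ex_intro _ (pair_measure : {sigma_finite_measure set (R * R)%type -> \bar R})
       grid_intersection_measure)).
apply: (saturation_mass pair_family grid_pair_orbit pair_hits
  measurable_YY transverse).
exact: integral_transverse_grid2_esum.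
Qed.

End punctured_grid.

Theorem mainTheorem7 (R : realType) (eps : R) (eps_gt0 : (0 < eps)%R) :
  exists (d : measure_display) (X : measurableType d) (act : R -> X -> X)
         (mu : probability X R) (Y : set X),
    [/\ transverse_space act mu Y,
        ergodic act mu,
        intensity act mu Y < intersection_covolume act mu Y &
        intersection_covolume act mu Y < (1 + eps)%:E * intensity act mu Y].
Proof.
pose m := (Num.truncn eps^-1).+2.
exists default_measure_display, R, (@rotation R), (circle_measure R),
  (@punctured_grid R m).
have m_gt1 : (1 < m)%N by [].
rewrite intensity_grid// intersection_covolume_grid//; split.
- exact: circle_transverse_space.
- exact: circle_ergodic.
- by rewrite lte_fin ltr_nat.
rewrite -EFinM lte_fin mulrDl mul1r -natr1 ltrD2l.
rewrite -ltr_pdivrMl// mulr1 (lt_trans (truncnS_gt _))//.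
by rewrite ltr_nat.
Qed.
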